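(* Let $k$ be an algebraically closed field of characteristic $0$, and let $K=\bigoplus_{n\ge0}K(n)$ be a connected coradically graded Hopf algebra over $k$. If $K$ is finitely generated as an algebra, then $K$ is isomorphic, as an algebra, to the polynomial ring over $k$ in $\ell$ variables for some $\ell\ge0$.
   Context: A Hopf algebra is connected if its coradical (the sum of all its simple subcoalgebras) is one-dimensional. A graded Hopf algebra is a Hopf algebra $K=\bigoplus_{i\ge0}K(i)$ which is both a graded algebra and a graded coalgebra with respect to this decomposition and whose antipode $S$ satisfies $S(K(n))\subset K(n)$ for all $n$. It is coradically graded if moreover $K_0=K(0)$ and $K_1=K(0)\oplus K(1)$, where $\{K_n\}$ is the coradical filtration of $K$. (So here $K(0)=k$.) *)

(* Defs.v *)
From HB Require Import structures.
From mathcomp Require Import all_boot all_order all_algebra.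
From mathcomp Require Import sesquilinear.
From mathcomp Require Import boolp classical_sets.

Set Implicit Arguments.
Unset Strict Implicit.
Unset Printing Implicit Defensive.

Import GRing.Theory.

Local Open Scope quotient_scope.
Local Open Scope ring_scope.

Reserved Notation "v ⊗ w" (at level 38, right associativity).

(* The tensor product of two modules over a commutative ring: finite formal   *)
(* sums of pairs, modulo the smallest additive congruence that makes the      *)
(* pairing bilinear.  Its universal property is proved below.                 *)
Section TensorProduct.
Variables (R : comNzRingType) (V W : lmodType R).

Inductive tensor_rel : seq (V * W) -> seq (V * W) -> Prop :=
| tensor_rel_refl s : tensor_rel s s
| tensor_rel_sym s t : tensor_rel s t -> tensor_rel t s
| tensor_rel_trans t s u : tensor_rel s t -> tensor_rel t u -> tensor_rel s u
| tensor_rel_cat s s' t t' :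
    tensor_rel s s' -> tensor_rel t t' -> tensor_rel (s ++ t) (s' ++ t')
| tensor_rel_catC s t : tensor_rel (s ++ t) (t ++ s)
| tensor_rel_0l w : tensor_rel [:: (0, w)] [::]
| tensor_rel_Dl v v' w : tensor_rel [:: (v + v', w)] [:: (v, w); (v', w)]
| tensor_rel_Dr v w w' : tensor_rel [:: (v, w + w')] [:: (v, w); (v, w')]
| tensor_rel_Z a v w : tensor_rel [:: (a *: v, w)] [:: (v, a *: w)].

Definition tensor_eqv (s t : seq (V * W)) : bool := `[< tensor_rel s t >].

Lemma tensor_eqv_refl : reflexive tensor_eqv.
Proof. by move=> s; apply/asboolP; apply: tensor_rel_refl. Qed.

Lemma tensor_eqv_sym : symmetric tensor_eqv.
Proof. by move=> s t; apply/asboolP/asboolP; apply: tensor_rel_sym. Qed.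

Lemma tensor_eqv_trans : transitive tensor_eqv.
Proof.
by move=> t s u /asboolP st /asboolP tu; apply/asboolP/(tensor_rel_trans st).
Qed.

Canonical tensor_equiv :=
  EquivRel tensor_eqv tensor_eqv_refl tensor_eqv_sym tensor_eqv_trans.

Definition tensor := {eq_quot tensor_equiv}.

HB.instance Definition _ := Choice.on tensor.
HB.instance Definition _ := EqQuotient.on tensor.

Local Notation pi s := (\pi_tensor s).

Lemma tensor_piP s t : reflect (pi s = pi t) `[< tensor_rel s t >].
Proof. exact: (@eqquotP _ tensor_equiv tensor). Qed.

Lemma tensor_pi_eq s t : tensor_rel s t -> pi s = pi t.
Proof. by move=> st; apply/tensor_piP/asboolP. Qed.

Lemma tensor_repr_rel s : tensor_rel (repr (pi s)) s.
Proof. by apply/asboolP/tensor_piP; rewrite reprK. Qed.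

Definition tensor_scale_seq (a : R) (s : seq (V * W)) :=
  [seq (a *: p.1, p.2) | p <- s].

Definition tensor_zero : tensor := pi [::].
Definition tensor_add (x y : tensor) : tensor := pi (repr x ++ repr y).
Definition tensor_scale (a : R) (x : tensor) : tensor :=
  pi (tensor_scale_seq a (repr x)).
Definition tensor_opp : tensor -> tensor := tensor_scale (-1).

Lemma tensor_scale_seq_rel a s t : tensor_rel s t ->
  tensor_rel (tensor_scale_seq a s) (tensor_scale_seq a t).
Proof.
elim=> {s t} [s|s t _|t s u _ IH1 _|s s' t t' _ IH1 _ IH2|s t|w|v v' w|v w w'
  |b v w].
- exact: tensor_rel_refl.
- exact: tensor_rel_sym.
- exact: tensor_rel_trans.
- by rewrite /tensor_scale_seq !map_cat; apply: tensor_rel_cat.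
- by rewrite /tensor_scale_seq !map_cat; apply: tensor_rel_catC.
- by rewrite /= scaler0; apply: tensor_rel_0l.
- by rewrite /= scalerDr; apply: tensor_rel_Dl.
- exact: tensor_rel_Dr.
- by rewrite /= scalerA mulrC -scalerA; apply: tensor_rel_Z.
Qed.

Lemma tensor_addE s t : tensor_add (pi s) (pi t) = pi (s ++ t).
Proof.
apply: tensor_pi_eq; apply: tensor_rel_cat; exact: tensor_repr_rel.
Qed.

Lemma tensor_scaleE a s : tensor_scale a (pi s) = pi (tensor_scale_seq a s).
Proof. by apply: tensor_pi_eq; apply/tensor_scale_seq_rel/tensor_repr_rel. Qed.

Lemma tensor_addA : associative tensor_add.
Proof.
elim/quotW=> x; elim/quotW=> y; elim/quotW=> z.
by rewrite (tensor_addE y z) (tensor_addE x y) !tensor_addE catA.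
Qed.

Lemma tensor_addC : commutative tensor_add.
Proof.
elim/quotW=> x; elim/quotW=> y; rewrite (tensor_addE x y) (tensor_addE y x).
exact/tensor_pi_eq/tensor_rel_catC.
Qed.

Lemma tensor_add0 : left_id tensor_zero tensor_add.
Proof. by elim/quotW=> x; rewrite tensor_addE. Qed.

Lemma tensor_scale_seq_add a b s : tensor_rel (tensor_scale_seq (a + b) s)
  (tensor_scale_seq a s ++ tensor_scale_seq b s).
Proof.
elim: s => [|[v w] s IH] /=; first exact: tensor_rel_refl.
rewrite scalerDl -[_ :: tensor_scale_seq (a + b) s]cat1s.
apply: tensor_rel_trans (tensor_rel_cat (tensor_rel_Dl _ _ _) IH) _.
rewrite /= -cat1s -[_ :: (tensor_scale_seq a s ++ _)]cat1s.
rewrite -[(a *: v, w) :: (tensor_scale_seq a s ++ _)]cat1s.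
apply: tensor_rel_cat; first exact: tensor_rel_refl.
rewrite -[_ :: tensor_scale_seq b s]cat1s !catA.
by apply: tensor_rel_cat; [apply: tensor_rel_catC|apply: tensor_rel_refl].
Qed.

Lemma tensor_addN : left_inverse tensor_zero tensor_opp tensor_add.
Proof.
elim/quotW=> x; rewrite /tensor_opp (tensor_scaleE (-1) x) tensor_addE.
have := tensor_scale_seq_add (-1) 1 x; rewrite addNr.
have -> : tensor_scale_seq 1 x = x.
  by rewrite -[RHS]map_id; apply: eq_map => -[v w] /=; rewrite scale1r.
move=> /tensor_pi_eq <-; apply: tensor_pi_eq.
elim: x => [|[v w] s IH] /=; first exact: tensor_rel_refl.
by rewrite scale0r -cat1s -[[::]]cats0; apply: tensor_rel_cat IH;
  apply: tensor_rel_0l.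
Qed.

HB.instance Definition _ := GRing.isZmodule.Build tensor
  tensor_addA tensor_addC tensor_add0 tensor_addN.

Lemma tensor_scalerA a b x :
  tensor_scale a (tensor_scale b x) = tensor_scale (a * b) x.
Proof.
elim/quotW: x => x; rewrite (tensor_scaleE b x) !tensor_scaleE.
rewrite /tensor_scale_seq -map_comp; congr (pi _).
by apply: eq_map => p /=; rewrite scalerA.
Qed.

Lemma tensor_scale1 : left_id 1 tensor_scale.
Proof.
elim/quotW=> x; rewrite tensor_scaleE; congr (pi _).
by rewrite -[RHS]map_id; apply: eq_map => -[v w] /=; rewrite scale1r.
Qed.

Lemma tensor_scaleDr : right_distributive tensor_scale +%R.
Proof.
move=> a; elim/quotW=> x; elim/quotW=> y.
rewrite [_ + _](tensor_addE x y) (tensor_scaleE a x) (tensor_scaleE a y).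
by rewrite tensor_scaleE [RHS]tensor_addE -map_cat.
Qed.

Lemma tensor_scaleDl x : {morph tensor_scale^~ x : a b / a + b}.
Proof.
move=> a b; elim/quotW: x => x.
rewrite (tensor_scaleE a x) (tensor_scaleE b x) tensor_scaleE [RHS]tensor_addE.
exact/tensor_pi_eq/tensor_scale_seq_add.
Qed.

HB.instance Definition _ := GRing.Zmodule_isLmodule.Build R tensor
  tensor_scalerA tensor_scale1 tensor_scaleDr tensor_scaleDl.

Definition tens (v : V) (w : W) : tensor := pi [:: (v, w)].
Local Notation "v ⊗ w" := (tens v w).

Lemma tens_bilinear : bilinear_for *:%R *:%R tens.
Proof.
have tZ a v w : a *: (v ⊗ w) = (a *: v) ⊗ w by apply: tensor_scaleE.
split=> [w|v] a x y /=; rewrite tZ.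
  rewrite [RHS]tensor_addE; exact/tensor_pi_eq/tensor_rel_Dl.
rewrite /tens (tensor_pi_eq (tensor_rel_Z a v x)) [RHS]tensor_addE.
exact/tensor_pi_eq/tensor_rel_Dr.
Qed.

HB.instance Definition _ :=
  bilinear_isBilinear.Build R V W tensor *:%R *:%R tens tens_bilinear.

Lemma pi_tensE s : pi s = \sum_(p <- s) p.1 ⊗ p.2.
Proof.
elim: s => [|[v w] s IH]; first by rewrite big_nil.
by rewrite big_cons -IH [RHS]tensor_addE.
Qed.

Lemma tensorE (x : tensor) : x = \sum_(p <- repr x) p.1 ⊗ p.2.
Proof. by rewrite -pi_tensE reprK. Qed.

Lemma tensor_ind (P : tensor -> Prop) :
  P 0 -> (forall x y, P x -> P y -> P (x + y)) -> (forall v w, P (v ⊗ w)) ->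
  forall x, P x.
Proof.
move=> P0 PD Pt x; rewrite [x]tensorE.
by elim/big_ind: _ => // p _; apply: Pt.
Qed.

Section Lift.
Variable Z : lmodType R.

(* The linear map out of the tensor product induced by a bilinear map b; the  *)
(* formula is meaningless when b is not bilinear.                             *)
Definition tensor_lift (b : V -> W -> Z) (x : tensor) : Z :=
  \sum_(p <- repr x) b p.1 p.2.

Variable b : V -> W -> Z.
Hypothesis b_bilin : bilinear_for *:%R *:%R b.

Let bDl v v' w : b (v + v') w = b v w + b v' w.
Proof. by have := b_bilin.1 w 1 v v'; rewrite /= !scale1r. Qed.
Let bDr v w w' : b v (w + w') = b v w + b v w'.
Proof. by have := b_bilin.2 v 1 w w'; rewrite /= !scale1r. Qed.
Let b0l w : b 0 w = 0.
Proof. by apply: (@addrI _ (b 0 w)); rewrite -bDl !addr0. Qed.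
Let b0r v : b v 0 = 0.
Proof. by apply: (@addrI _ (b v 0)); rewrite -bDr !addr0. Qed.
Let bZl a v w : b (a *: v) w = a *: b v w.
Proof. by have := b_bilin.1 w a v 0; rewrite /= !addr0 b0l addr0. Qed.
Let bZr a v w : b v (a *: w) = a *: b v w.
Proof. by have := b_bilin.2 v a w 0; rewrite /= !addr0 b0r addr0. Qed.

Let lift_rel s t : tensor_rel s t ->
  \sum_(p <- s) b p.1 p.2 = \sum_(p <- t) b p.1 p.2.
Proof.
elim=> {s t} // [t s u _ -> _ -> //|s s' t t' _ IH1 _ IH2|s t|w|v v' w|v w w'
  |a v w]; rewrite ?big_cat ?big_cons ?big_nil /= ?addr0.
- by rewrite IH1 IH2.
- by rewrite addrC.
- exact: b0l.
- exact: bDl.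
- exact: bDr.
- by rewrite bZl bZr.
Qed.

Lemma tensor_lift_pi s : tensor_lift b (pi s) = \sum_(p <- s) b p.1 p.2.
Proof. exact/lift_rel/tensor_repr_rel. Qed.

Lemma tensor_liftE v w : tensor_lift b (v ⊗ w) = b v w.
Proof. by rewrite tensor_lift_pi big_seq1. Qed.

Lemma tensor_lift_linear : linear (tensor_lift b).
Proof.
move=> a; elim/quotW=> x; elim/quotW=> y.
rewrite [a *: _](tensor_scaleE a x) [_ + pi y]tensor_addE !tensor_lift_pi big_cat /=.
rewrite big_map scaler_sumr; congr (_ + _).
by apply: eq_bigr => p _; rewrite bZl.
Qed.

Lemma tensor_lift_unique (f : {linear tensor -> Z}) :
  (forall v w, f (v ⊗ w) = b v w) -> f =1 tensor_lift b.
Proof.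
move=> fE x; rewrite [x in LHS]tensorE linear_sum.
by apply: eq_bigr => p _; rewrite fE.
Qed.

End Lift.

End TensorProduct.

Notation "v ⊗ w" := (tens v w) : ring_scope.

Section TensorMaps.
Variable R : comNzRingType.
Implicit Types U V W : lmodType R.

Lemma tensPl V W a (v v' : V) (w : W) :
  (a *: v + v') ⊗ w = a *: (v ⊗ w) + v' ⊗ w.
Proof. exact: (tens_bilinear V W).1. Qed.

Lemma tensPr V W a (v : V) (w w' : W) :
  v ⊗ (a *: w + w') = a *: (v ⊗ w) + v ⊗ w'.
Proof. exact: (tens_bilinear V W).2. Qed.

Definition tensor_map V V' W W' (f : V -> V') (g : W -> W') :
    tensor V W -> tensor V' W' :=
  tensor_lift (fun v w => f v ⊗ g w).

Definition tensor_assoc U V W :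
    tensor (tensor U V) W -> tensor U (tensor V W) :=
  tensor_lift (fun x w => tensor_lift (fun u v => u ⊗ (v ⊗ w)) x).

Definition tensor_lunit V : tensor R^o V -> V :=
  tensor_lift (fun (a : R^o) v => (a : R) *: v).

Definition tensor_runit V : tensor V R^o -> V :=
  tensor_lift (fun v (a : R^o) => (a : R) *: v).

Lemma tensor_mapE V V' W W' (f : {linear V -> V'}) (g : {linear W -> W'}) v w :
  tensor_map f g (v ⊗ w) = f v ⊗ g w.
Proof.
apply: tensor_liftE; split=> [y|x] a u u' /=; rewrite linearP.
  exact: tensPl.
exact: tensPr.
Qed.

Lemma tensor_assocE U V W (u : U) (v : V) (w : W) :
  tensor_assoc ((u ⊗ v) ⊗ w) = u ⊗ (v ⊗ w).
Proof.
have bi w' : bilinear_for *:%R *:%R (fun (u : U) (v : V) => u ⊗ (v ⊗ w')).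
  split=> [y|x] a t t' /=; first exact: tensPl.
  by rewrite tensPl tensPr.
rewrite /tensor_assoc tensor_liftE ?tensor_liftE //.
split=> [y|x] a t t' /=; first exact: tensor_lift_linear.
rewrite /tensor_lift scaler_sumr -big_split /=; apply: eq_bigr => p _.
by rewrite !tensPr.
Qed.

Lemma tensor_lunitE V (a : R) (v : V) : tensor_lunit ((a : R^o) ⊗ v) = a *: v.
Proof.
apply: tensor_liftE; split=> [y|x] b t t' /=; first by rewrite scalerDl scalerA.
by rewrite scalerDr !scalerA mulrC.
Qed.

Lemma tensor_runitE V (a : R) (v : V) : tensor_runit (v ⊗ (a : R^o)) = a *: v.
Proof.
apply: tensor_liftE; split=> [y|x] b t t' /=; last by rewrite scalerDl scalerA.
by rewrite scalerDr !scalerA mulrC.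
Qed.

End TensorMaps.

(* The algebra structure on A ⊗ B with (a ⊗ b)(a' ⊗ b') = aa' ⊗ bb'.          *)
Section TensorAlgebra.
Variables (R : comNzRingType) (A B : algType R).
Local Notation T := (tensor A B).

Definition tensor_one : T := 1 ⊗ 1.
Definition tensor_mul (x y : T) : T :=
  tensor_lift (fun a b => tensor_lift (fun a' b' => (a * a') ⊗ (b * b')) y) x.

Let bi_in a b :
  bilinear_for *:%R *:%R (fun (a' : A) (b' : B) => (a * a') ⊗ (b * b')).
Proof.
split=> [y|x] c t t' /=; rewrite mulrDr -scalerAr.
  exact: tensPl.
exact: tensPr.
Qed.

Let bi_out y : bilinear_for *:%R *:%R
  (fun a b => tensor_lift (fun a' b' => (a * a') ⊗ (b * b')) y : T).
Proof.
split=> [v|u] c t t' /=; rewrite /tensor_lift scaler_sumr -big_split /=;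
  apply: eq_bigr => p _; rewrite mulrDl -scalerAl.
  exact: tensPl.
exact: tensPr.
Qed.

Lemma tensor_mulE a b a' b' :
  tensor_mul (a ⊗ b) (a' ⊗ b') = (a * a') ⊗ (b * b').
Proof. by rewrite /tensor_mul !tensor_liftE. Qed.

Lemma tensor_mulDl : left_distributive tensor_mul +%R.
Proof.
move=> x y z; have := tensor_lift_linear (bi_out z) 1 x y.
by rewrite !scale1r.
Qed.

Lemma tensor_mulDr : right_distributive tensor_mul +%R.
Proof.
move=> x y z; rewrite /tensor_mul {1 4 5}/tensor_lift -big_split /=.
apply: eq_bigr => p _; have := tensor_lift_linear (bi_in p.1 p.2) 1 y z.
by rewrite !scale1r.
Qed.

Let mul0t x : tensor_mul 0 x = 0.
Proof.
by apply: (@addrI _ (tensor_mul 0 x)); rewrite -tensor_mulDl !addr0.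
Qed.
Let mult0 x : tensor_mul x 0 = 0.
Proof.
by apply: (@addrI _ (tensor_mul x 0)); rewrite -tensor_mulDr !addr0.
Qed.

Lemma tensor_mulA : associative tensor_mul.
Proof.
move=> x y z; elim/tensor_ind: x => [|x x' IH IH'|a b].
- by rewrite !mul0t.
- by rewrite !tensor_mulDl IH IH'.
elim/tensor_ind: y => [|y y' IH IH'|a' b'].
- by rewrite mult0 !mul0t mult0.
- by rewrite tensor_mulDr !tensor_mulDl -IH -IH' tensor_mulDr.
elim/tensor_ind: z => [|z z' IH IH'|a'' b''].
- by rewrite !mult0.
- by rewrite !tensor_mulDr IH IH'.
by rewrite !tensor_mulE !mulrA.
Qed.

Lemma tensor_mul1l : left_id tensor_one tensor_mul.
Proof.
move=> x; elim/tensor_ind: x => [|x y IH IH'|a b].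
- exact: mult0.
- by rewrite tensor_mulDr IH IH'.
by rewrite tensor_mulE !mul1r.
Qed.

Lemma tensor_mul1r : right_id tensor_one tensor_mul.
Proof.
move=> x; elim/tensor_ind: x => [|x y IH IH'|a b].
- exact: mul0t.
- by rewrite tensor_mulDl IH IH'.
by rewrite tensor_mulE !mulr1.
Qed.

(* Only a possibly-zero ring: over a general R, A ⊗ B may vanish.            *)
HB.instance Definition _ := GRing.Zmodule_isPzRing.Build T
  tensor_mulA tensor_mul1l tensor_mul1r tensor_mulDl tensor_mulDr.

End TensorAlgebra.

Definition tensor_mulmap (R : comNzRingType) (A : algType R) :
    tensor A A -> A :=
  tensor_lift (fun a b => a * b).

Lemma tensor_mulmapE (R : comNzRingType) (A : algType R) (a b : A) :
  tensor_mulmap (a ⊗ b) = a * b.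
Proof.
apply: tensor_liftE; split=> [y|x] c t t' /=.
  by rewrite mulrDl scalerAl.
by rewrite mulrDr scalerAr.
Qed.

HB.mixin Record Lmodule_isCoalgebra (k : fieldType) C of GRing.Lmodule k C := {
  comul : C -> tensor C C;
  counit : C -> k^o;
  comul_linear : linear comul;
  counit_linear : linear counit;
  comulA : forall x,
    tensor_assoc (tensor_map comul idfun (comul x))
      = tensor_map idfun comul (comul x);
  comul_counitl : forall x,
    tensor_lunit (tensor_map counit idfun (comul x)) = x;
  comul_counitr : forall x,
    tensor_runit (tensor_map idfun counit (comul x)) = x;
}.

#[short(type="coalgType")]
HB.structure Definition Coalgebra (k : fieldType) :=
  {C of GRing.Lmodule k C & Lmodule_isCoalgebra k C}.

HB.instance Definition _ (k : fieldType) (C : coalgType k) :=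
  GRing.isLinear.Build k C (tensor C C) *:%R (@comul k C) comul_linear.
HB.instance Definition _ (k : fieldType) (C : coalgType k) :=
  GRing.isLinear.Build k C k^o *:%R (@counit k C) counit_linear.

HB.mixin Record isHopfAlgebra (k : fieldType) H
    of GRing.Algebra k H & Coalgebra k H := {
  antipode : H -> H;
  comul_monoid_morphism : monoid_morphism (@comul k H);
  counit_monoid_morphism : monoid_morphism (@counit k H);
  antipode_linear : linear antipode;
  antipodel : forall x : H,
    tensor_mulmap (tensor_map antipode idfun (comul x)) = (counit x : k)%:A;
  antipoder : forall x : H,
    tensor_mulmap (tensor_map idfun antipode (comul x)) = (counit x : k)%:A;
}.

#[short(type="hopfAlgType")]
HB.structure Definition HopfAlgebra (k : fieldType) :=
  {H of GRing.Algebra k H & Coalgebra k H & isHopfAlgebra k H}.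

HB.instance Definition _ (k : fieldType) (H : hopfAlgType k) :=
  GRing.isMonoidMorphism.Build H (tensor H H) (@comul k H)
    comul_monoid_morphism.
HB.instance Definition _ (k : fieldType) (H : hopfAlgType k) :=
  GRing.isMonoidMorphism.Build H k^o (@counit k H) counit_monoid_morphism.
HB.instance Definition _ (k : fieldType) (H : hopfAlgType k) :=
  GRing.isLinear.Build k H H *:%R (@antipode k H) antipode_linear.

Local Open Scope classical_set_scope.

Section Subspaces.
Variable k : fieldType.
Implicit Types V W : lmodType k.

Definition subspace V (A : set V) : Prop := GRing.submod_closed (mem A).

Definition span V (S : set V) : set V := smallest (@subspace V) S.

Definition addsub V (A B : set V) : set V := span (A `|` B).

Definition tensorsub V W (A : set V) (B : set W) : set (tensor V W) :=
  span [set v ⊗ w | v in A & w in B].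

Definition one_dimensional V (A : set V) : Prop :=
  exists2 x, x != 0 & A = span [set x].

(* V is the internal direct sum of the V_ n; f lists the components of x.     *)
Definition direct_sum_decomposition V (V_ : nat -> set V) : Prop :=
  [/\ forall n, subspace (V_ n),
      forall x, exists N (f : nat -> V),
        (forall n, V_ n (f n)) /\ x = \sum_(n < N) f n
    & forall N (f : nat -> V), (forall n, V_ n (f n)) ->
        \sum_(n < N) f n = 0 -> forall n, (n < N)%N -> f n = 0].

End Subspaces.

Section Coradical.
Variables (k : fieldType) (C : coalgType k).

Definition subcoalgebra (D : set C) : Prop :=
  subspace D /\ (forall x, D x -> tensorsub D D (comul x)).

Definition simple_subcoalgebra (D : set C) : Prop :=
  [/\ subcoalgebra D, D <> [set 0]
    & forall E, subcoalgebra E -> E `<=` D -> E = [set 0] \/ E = D].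

Definition coradical : set C :=
  span (\bigcup_(D in simple_subcoalgebra) D).

(* C_0 is the coradical and C_(m+1) is the inverse image under comul of       *)
(* C ⊗ C_m + C_0 ⊗ C.                                                         *)
Fixpoint coradical_filtration (n : nat) : set C :=
  if n is m.+1 then
    [set x | addsub (tensorsub setT (coradical_filtration m))
                    (tensorsub coradical setT) (comul x)]
  else coradical.

Definition connected : Prop := one_dimensional coradical.

End Coradical.

Arguments coradical {k} C _.
Arguments coradical_filtration {k} C n _.
Arguments connected {k} C.

Definition graded_algebra (k : fieldType) (A : algType k) (A_ : nat -> set A)
    : Prop :=
  [/\ direct_sum_decomposition A_, A_ 0%N 1
    & forall i j x y, A_ i x -> A_ j y -> A_ (i + j)%N (x * y)].

Definition graded_coalgebra (k : fieldType) (C : coalgType k)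
    (C_ : nat -> set C) : Prop :=
  [/\ direct_sum_decomposition C_,
      forall n x, C_ n x ->
        span (\bigcup_(i in [set i | (i <= n)%N])
                tensorsub (C_ i) (C_ (n - i)%N)) (comul x)
    & forall n x, (0 < n)%N -> C_ n x -> counit x = 0].

Section GradedHopf.
Variables (k : fieldType) (K : hopfAlgType k) (K_ : nat -> set K).

Definition graded_hopf_algebra : Prop :=
  [/\ graded_algebra K_, graded_coalgebra K_
    & forall n x, K_ n x -> K_ n (antipode x)].

Definition coradically_graded : Prop :=
  [/\ graded_hopf_algebra,
      coradical_filtration K 0 = K_ 0%N
    & coradical_filtration K 1 = addsub (K_ 0%N) (K_ 1%N)].

End GradedHopf.

Definition finitely_generated (k : fieldType) (A : algType k) : Prop :=
  exists s : seq A,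
    smallest [set B : set A | GRing.subalg_closed (mem B)] [set` s] = setT.

(* Main.v *)
From HB Require Import structures.
Require Import Defs.
From mathcomp Require Import all_boot all_order all_algebra.
From mathcomp Require Import boolp classical_sets.
From mathcomp Require Import mpoly.
From mathcomp Require Import zify.

(* K is commutative: for homogeneous x, y of positive degree, induction on    *)
(* the total degree shows Delta [x, y] in K ⊗ k + k ⊗ K, so [x, y] lies in    *)
(* K_1 = K(0) + K(1), and it vanishes since its degree is at least 2.         *)
(* Next take homogeneous generators x_1, .., x_l of degrees d_i > 0, none     *)
(* of them redundant.  A relation among them has no linear part, so the       *)
(* coefficient of the j-th variable is a well-defined functional phi_j on K,  *)
(* and it is a derivation at the counit.  Hence D_j = (id ⊗ phi_j) Delta is a *)
(* derivation of K, with D_j x_i = delta_ij if d_i = d_j and D_j x_i = 0 if   *)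
(* d_i < d_j.  Applying the D_j to a relation P(x) = 0 and descending on d_j, *)
(* one gets (dP/dX_j)(x) = 0 for all j; in characteristic 0 induction on the  *)
(* degree of P gives P = 0.                                                   *)

Set Implicit Arguments.
Unset Strict Implicit.
Unset Printing Implicit Defensive.

Import GRing.Theory.
Local Open Scope ring_scope.

(** Commutators of homogeneous elements of positive degree have degree at least 2, while the
    coproduct forces them into K(0) + K(1); this is [homog_comm], whence [coradically_graded_comm].
    With K commutative, evaluation [mev x] at a minimal family of homogeneous generators is a
    surjective algebra map, and everything rests on its kernel. That kernel is homogeneous and, by
    minimality, free of linear terms ([irredundant_linear_coeff]), so the linear coefficients
    descend to functionals on K, which the coproduct turns into derivations [dual_deriv]. When the
    generators are ordered by degree, the matrix of the D_i x_j is unitriangular ([dual_deriv_lt],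
    [dual_deriv_eq]). The chain rule then makes the kernel stable under partial derivatives
    ([mev_inj]), and in characteristic 0 such a kernel is zero ([mev_inj_deriv]). *)

(** * Subspaces and spans *)

Section Subspaces.
Variable k : fieldType.
Implicit Types V W : lmodType k.

Lemma subspaceP V (A : set V) :
  subspace A <-> A 0 /\ forall a x y, A x -> A y -> A (a *: x + y).
Proof.
split=> -[A0 AD]; split=> //.
- by have := A0; rewrite inE.
- by move=> a x y Ax Ay; have := AD a x y; rewrite !inE; apply.
- by rewrite inE.
- by move=> a x y; rewrite !inE; apply: AD.
Qed.

Lemma subspaceD V (A : set V) x y : subspace A -> A x -> A y -> A (x + y).
Proof. by case/subspaceP=> _ AD Ax Ay; rewrite -[x]scale1r; apply: AD. Qed.

Lemma subspaceZ V (A : set V) a x : subspace A -> A x -> A (a *: x).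
Proof. by case/subspaceP=> A0 AD Ax; rewrite -[_ *: _]addr0; apply: AD. Qed.

Lemma subspaceN V (A : set V) x : subspace A -> A x -> A (- x).
Proof. by move=> sA Ax; rewrite -scaleN1r; apply: subspaceZ. Qed.

Lemma subspace_sum V (A : set V) (I : Type) (r : seq I) (P : pred I) F :
  subspace A -> (forall i, P i -> A (F i)) -> A (\sum_(i <- r | P i) F i).
Proof.
move=> sA AF; elim/big_ind: _ => //; first by case/subspaceP: sA.
by move=> x y Ax Ay; apply: subspaceD.
Qed.

Lemma subspace_span V (S : set V) : subspace (Defs.span S).
Proof.
apply/subspaceP; split=> [A [/subspaceP[] //]|a x y Sx Sy A [sA SA]].
have [_ AD] := (subspaceP A).1 sA.
by apply: AD; [apply: Sx|apply: Sy].
Qed.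

Lemma span_min V (S A : set V) : subspace A -> (S `<=` A)%classic ->
  forall x, Defs.span S x -> A x.
Proof. by move=> sA SA x; apply. Qed.

Lemma span_gen V (S : set V) x : S x -> Defs.span S x.
Proof. by move=> Sx A [_]; apply. Qed.

Lemma subspace_preim V W (f : {linear V -> W}) (A : set W) :
  subspace A -> subspace [set x | A (f x)].
Proof.
case/subspaceP=> A0 AD; apply/subspaceP; split=> [|a x y Ax Ay] /=.
  by rewrite linear0.
by rewrite linearP; apply: AD.
Qed.

End Subspaces.

(** * Contractions and commutators in tensor products *)

Section TensorLinear.
Variable R : comNzRingType.
Implicit Types U V W : lmodType R.

Lemma tensor_map_linear V V' W W' (f : {linear V -> V'}) (g : {linear W -> W'}) :
  linear (tensor_map f g).
Proof.
apply: tensor_lift_linear; split=> [y|x] a u u' /=; rewrite linearP.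
  exact: tensPl.
exact: tensPr.
Qed.

HB.instance Definition _ V V' W W' (f : {linear V -> V'}) (g : {linear W -> W'}) :=
  GRing.isLinear.Build R (tensor V W) (tensor V' W') *:%R (tensor_map f g)
    (tensor_map_linear f g).

Lemma tensor_lunit_linear V : linear (@tensor_lunit R V).
Proof.
apply: tensor_lift_linear; split=> [y|x] b t t' /=.
  by rewrite scalerDl scalerA.
by rewrite scalerDr !scalerA mulrC.
Qed.

HB.instance Definition _ V :=
  GRing.isLinear.Build R (tensor R^o V) V *:%R (@tensor_lunit R V)
    (@tensor_lunit_linear V).

Lemma tensor_runit_linear V : linear (@tensor_runit R V).
Proof.
apply: tensor_lift_linear; split=> [y|x] b t t' /=.
  by rewrite scalerDr !scalerA mulrC.
by rewrite scalerDl scalerA.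
Qed.

HB.instance Definition _ V :=
  GRing.isLinear.Build R (tensor V R^o) V *:%R (@tensor_runit R V)
    (@tensor_runit_linear V).

(** The contraction id ⊗ phi, with V ⊗ R identified with V. *)
Definition slice V W (phi : W -> R^o) (t : tensor V W) : V :=
  tensor_runit (tensor_map idfun phi t).

Lemma slice_linear V W (phi : {linear W -> R^o}) : linear (@slice V W phi).
Proof. by move=> a x y; rewrite /slice !linearP. Qed.

HB.instance Definition _ V W (phi : {linear W -> R^o}) :=
  GRing.isLinear.Build R (tensor V W) V *:%R (@slice V W phi)
    (@slice_linear V W phi).

Lemma sliceE V W (phi : {linear W -> R^o}) (v : V) w :
  slice phi (v ⊗ w) = (phi w : R) *: v.
Proof. by rewrite /slice tensor_mapE tensor_runitE. Qed.

(** Both sides are the contraction psi ⊗ phi, computed in the two possible orders. *)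
Lemma slice_slice V W (psi : {linear V -> R^o}) (phi : {linear W -> R^o}) t :
  psi (slice phi t) = phi (tensor_lunit (tensor_map psi idfun t)).
Proof.
elim/tensor_ind: t => [|t u IHt IHu|v w]; first by rewrite !linear0.
  by rewrite !linearD /= IHt IHu.
by rewrite sliceE tensor_mapE tensor_lunitE !linearZ; apply: mulrC.
Qed.

(** Source of the Leibniz rule for [dual_deriv]: on coproducts, with [eps] the counit, the slices
    along [eps] give back the original elements. *)
Lemma slice_mul (A : algType R) (eps phi : {linear A -> R^o}) :
  (forall a b, phi (a * b) = phi a * eps b + eps a * phi b) ->
  forall t u : tensor A A,
  slice phi (t * u) = slice phi t * slice eps u + slice eps t * slice phi u.
Proof.
move=> phiM; elim/tensor_ind=> [u|t t' IH IH' u|a b].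
- by rewrite !(mul0r, linear0) addr0.
- by rewrite !(mulrDl, linearD) /= IH IH' addrACA.
elim/tensor_ind=> [|u u' IH IH'|c d].
- by rewrite !(mulr0, linear0) addr0.
- by rewrite !(mulrDr, linearD) /= IH IH' addrACA.
rewrite [(a ⊗ b) * _]tensor_mulE !sliceE phiM -!scalerAl -!scalerAr !scalerA.
by rewrite -scalerDl.
Qed.

Lemma tensZl V W a (v : V) (w : W) : (a *: v) ⊗ w = a *: (v ⊗ w).
Proof. exact: linearZl_LR. Qed.

Lemma tensor_scalerAl (A B : algType R) a (t u : tensor A B) :
  (a *: t) * u = a *: (t * u).
Proof.
elim/tensor_ind: t => [|t t' IH IH'|x y].
- by rewrite scaler0 mul0r scaler0.
- by rewrite scalerDr !mulrDl scalerDr IH IH'.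
elim/tensor_ind: u => [|u u' IH IH'|x' y'].
- by rewrite !mulr0 scaler0.
- by rewrite !mulrDr scalerDr IH IH'.
rewrite -tensZl [_ * _]tensor_mulE [(x ⊗ y) * _]tensor_mulE.
by rewrite -scalerAl tensZl.
Qed.

Lemma tensor_scalerAr (A B : algType R) a (t u : tensor A B) :
  t * (a *: u) = a *: (t * u).
Proof.
elim/tensor_ind: t => [|t t' IH IH'|x y].
- by rewrite !mul0r scaler0.
- by rewrite !mulrDl scalerDr IH IH'.
elim/tensor_ind: u => [|u u' IH IH'|x' y'].
- by rewrite scaler0 !mulr0 scaler0.
- by rewrite scalerDr !mulrDr scalerDr IH IH'.
rewrite -tensZl [_ * _]tensor_mulE [(x ⊗ y) * _]tensor_mulE.
by rewrite -scalerAr tensZl.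
Qed.

(** Linearity in [t] allows membership of a commutator in a subspace to be tested on pure
    tensors. *)
Definition tensor_commutator (A B : algType R) (u t : tensor A B) := t * u - u * t.

Lemma tensor_commutator_linear (A B : algType R) (u : tensor A B) :
  linear (tensor_commutator u).
Proof.
move=> a x y; rewrite /tensor_commutator mulrDl mulrDr.
rewrite tensor_scalerAl tensor_scalerAr scalerBr.
by rewrite opprD addrACA.
Qed.

HB.instance Definition _ (A B : algType R) (u : tensor A B) :=
  GRing.isLinear.Build R (tensor A B) (tensor A B) *:%R (tensor_commutator u)
    (@tensor_commutator_linear A B u).

End TensorLinear.

(** * Lines, sums and direct sums of subspaces *)

Lemma span_set1P (k : fieldType) (V : lmodType k) (x y : V) :
  Defs.span [set x]%classic y -> exists c, y = c *: x.
Proof.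
move: y; apply: span_min => [|_ ->]; last by exists 1; rewrite scale1r.
apply/subspaceP; split=> [|a _ _ [c ->] [d ->]]; first by exists 0; rewrite scale0r.
by exists (a * c + d); rewrite scalerDl scalerA.
Qed.

Lemma addsubP (k : fieldType) (V : lmodType k) (A B : set V) x :
  subspace A -> subspace B -> addsub A B x ->
  exists a b, [/\ A a, B b & x = a + b].
Proof.
move=> sA sB; have [A0 AD] := (subspaceP A).1 sA.
have [B0 BD] := (subspaceP B).1 sB.
move: x; apply: span_min => [|x [Ax|Bx]]; last 2 first.
- by exists x, 0; rewrite addr0.
- by exists 0, x; rewrite add0r.
apply/subspaceP; split=> [|c _ _ [a [b [Aa Bb ->]]] [a' [b' [Aa' Bb' ->]]]].
  by exists 0, 0; rewrite addr0.
exists (c *: a + a'), (c *: b + b'); split; [exact: AD|exact: BD|].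
by rewrite scalerDr addrACA.
Qed.

(** Inserting the negative of the sum as a component of degree [n], where nothing stood, yields a
    vanishing sum of homogeneous terms; independence kills each of them. *)
Lemma direct_sum_exclude (k : fieldType) (V : lmodType k) (V_ : nat -> set V) :
  direct_sum_decomposition V_ ->
  forall N (f : nat -> V) n, (forall m, V_ m (f m)) -> f n = 0 ->
  V_ n (\sum_(m < N) f m) -> \sum_(m < N) f m = 0.
Proof.
move=> [sV _ V_free] N f n Vf fn0 Vn; set v := \sum_(m < N) f m in Vn *.
pose g m := if m == n then - v else if (m < N)%N then f m else 0.
have Vg m : V_ m (g m).
  rewrite /g; case: eqP => [->|_]; first exact: subspaceN.
  by case: ifP => // _; case/subspaceP: (sV m).
(* The range is enlarged because [n] may lie outside the original one. *)
have ltnM : (n < (n + N).+1)%N by rewrite ltnS leq_addr.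
have leNM : (N <= (n + N).+1)%N by rewrite leqW // leq_addl.
have g0 : \sum_(m < (n + N).+1) g m = 0.
  have vE : v = \sum_(m < (n + N).+1) if (m < N)%N then f m else 0.
    by rewrite /v (big_ord_widen _ f leNM) big_mkcond.
  rewrite (bigD1 (Ordinal ltnM)) //= {1}/g eqxx {1}vE.
  rewrite (bigD1 (Ordinal ltnM)) //= fn0 if_same add0r addrC -sumrB big1 // => m.
  by rewrite -val_eqE /g /= => /negbTE->; rewrite subrr.
apply/eqP; rewrite -oppr_eq0; apply/eqP.
by have := V_free _ g Vg g0 n ltnM; rewrite /g eqxx.
Qed.

(** * Commutativity of K *)

Section Commutativity.
Variables (k : fieldType) (K : hopfAlgType k) (K_ : nat -> set K).
Hypothesis Kcoradgr : coradically_graded K_.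
Hypothesis Kconn : connected K.

Let Kdec : direct_sum_decomposition K_.
Proof. by case: Kcoradgr => -[[]]. Qed.

Lemma homog_subspace n : subspace (K_ n).
Proof. by case: Kdec => + _ _; apply. Qed.

Lemma homog1 : K_ 0%N 1.
Proof. by case: Kcoradgr => -[[]]. Qed.

Lemma homogM i j x y : K_ i x -> K_ j y -> K_ (i + j)%N (x * y).
Proof. by case: Kcoradgr => -[[_ _ KM] _ _] _ _; apply: KM. Qed.

Lemma homog_comul n x : K_ n x ->
  Defs.span (\bigcup_(i in [set i | (i <= n)%N])
               tensorsub (K_ i) (K_ (n - i)%N))%classic (comul x).
Proof. by case: Kcoradgr => -[_ [_ + _] _] _ _; apply. Qed.

Lemma homog_counit n x : (0 < n)%N -> K_ n x -> counit x = 0.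
Proof. by case: Kcoradgr => -[_ [_ _ +] _] _ _; apply. Qed.

(** K(0) is the coradical, a line by connectedness, and it contains 1. *)
Lemma homog0P x : K_ 0%N x -> exists c, x = c%:A.
Proof.
have K0E : coradical K = K_ 0%N by case: Kcoradgr.
case: Kconn => z z0; rewrite K0E => K0z K0x.
have := homog1; rewrite K0z => /span_set1P[b b1].
move: K0x; rewrite K0z => /span_set1P[c ->].
have b0 : b != 0.
  by apply: contra_eq_neq b1 => ->; rewrite scale0r oner_neq0.
by exists (c / b); rewrite b1 scalerA mulfVK.
Qed.

Lemma homog_comm0 x y : K_ 0%N x -> x * y = y * x.
Proof. by case/homog0P=> c ->; rewrite -scalerAl -scalerAr mul1r mulr1. Qed.

Lemma homog_tensor_ind n (P : set (tensor K K)) : subspace P ->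
  (forall i x y, (i <= n)%N -> K_ i x -> K_ (n - i)%N y -> P (x ⊗ y)) ->
  forall t, Defs.span (\bigcup_(i in [set i | (i <= n)%N])
               tensorsub (K_ i) (K_ (n - i)%N))%classic t -> P t.
Proof.
move=> sP Pt; apply: span_min => // t [i /= le_in]; move: t.
by apply: span_min => // _ [x Kx [y Ky <-]]; apply: Pt Ky.
Qed.

(* Delta [x, y] has no component in degrees (p, q) with p, q > 0, since there *)
(* the factors commute by induction.  Hence [x, y] lies in K_1 = K(0) + K(1). *)
Lemma homog_comm i j x y : K_ i x -> K_ j y -> x * y = y * x.
Proof.
have [n] := ubnP (i + j)%N; elim: n i j x y => // n IH i j x y.
rewrite ltnS => le_ij_n Kx Ky.
have [i0|i_gt0] := posnP i; first by apply: homog_comm0; rewrite -i0.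
have [j0|j_gt0] := posnP j; first by apply/esym/homog_comm0; rewrite -j0.
apply/eqP; rewrite -subr_eq0; apply/eqP; set z := x * y - y * x.
have Kz : K_ (i + j)%N z.
  apply: (subspaceD (homog_subspace _)); first exact: homogM.
  by apply: (subspaceN (homog_subspace _)); rewrite addnC; apply: homogM.
pose M := addsub (tensorsub setT (coradical_filtration K 0))
                 (tensorsub (coradical K) setT).
have K0E : coradical K = K_ 0%N by case: Kcoradgr.
have sM : subspace M by apply: subspace_span.
have Mcomul : M (comul z).
  rewrite /z linearB !rmorphM /=.
  move: (comul x) (homog_comul Kx); apply: homog_tensor_ind.
    exact: (subspace_preim (tensor_commutator (comul y)) sM).
  move=> p a b le_pi Ka Kb; rewrite -opprB; apply: (subspaceN sM).
  move: (comul y) (homog_comul Ky); apply: homog_tensor_ind.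
    exact: (subspace_preim (tensor_commutator (a ⊗ b)) sM).
  move=> q c d le_qj Kc Kd.
  rewrite /= [_ * _]tensor_mulE [(a ⊗ b) * _]tensor_mulE.
  (* The left factors have total degree p + q and the right ones i + j - (p + q). Unless p + q is 0
     or i + j, both pairs commute by induction; in these extreme cases one pair is scalar and the
     term lies in K_0 ⊗ K or K ⊗ K_0. *)
  have [ge_pq|lt_pq] := leqP (i + j)%N (p + q).
    have pi : p = i by lia.
    have qj : q = j by lia.
    rewrite pi subnn in Kb; rewrite qj subnn in Kd.
    rewrite -(homog_comm0 d Kb) -linearBl /=; apply: span_gen; left.
    apply: span_gen; exists (c * a - a * c) => //; exists (b * d) => //.
    by rewrite /= K0E; apply: (homogM Kb Kd).
  rewrite (IH q p c a) //; last by lia.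
  have [pq0|pq_gt0] := posnP (p + q); last first.
    rewrite (IH _ _ d b _ Kd Kb) ?subrr; first by case/subspaceP: sM.
    by lia.
  have p0 : p = 0%N by lia.
  have q0 : q = 0%N by lia.
  rewrite p0 in Ka; rewrite q0 in Kc.
  rewrite -linearBr; apply: span_gen; right.
  apply: span_gen; exists (a * c); first by rewrite K0E; apply: (homogM Ka Kc).
  by exists (d * b - b * d).
have : coradical_filtration K 1 z by [].
case: Kcoradgr => _ _ ->.
move=> /(addsubP (homog_subspace _) (homog_subspace _))[a [b [K0a K1b zE]]].
(* The components of z in degrees 0 and 1; its own degree i + j is at least 2, so they must
   vanish. *)
pose f m := if m == 0%N then a else if m == 1%N then b else 0.
have Kf m : K_ m (f m).
  rewrite /f; case: eqP => [->//|_]; case: eqP => [->//|_].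
  by case/subspaceP: (homog_subspace m).
have fE : \sum_(m < 2) f m = z by rewrite !big_ord_recl big_ord0 addr0 zE.
rewrite -fE; apply: (direct_sum_exclude Kdec (n := (i + j)%N)) => //.
  by rewrite /f !gtn_eqF // -addn1 leq_add.
by rewrite fE.
Qed.

Lemma coradically_graded_comm (x y : K) : x * y = y * x.
Proof.
case: Kdec => _ K_gen _.
have [[N [f [Kf ->]]] [M [g [Kg ->]]]] := (K_gen x, K_gen y).
rewrite mulr_suml mulr_sumr; apply: eq_bigr => i _.
by rewrite mulr_suml mulr_sumr; apply: eq_bigr => j _; apply: homog_comm.
Qed.

End Commutativity.

(** * Evaluation of polynomials and the chain rule *)

Lemma mpoly_subalg_ind (n : nat) (R : comNzRingType) (P : {mpoly R[n]} -> Prop) :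
  P 1 -> (forall a p q, P p -> P q -> P (a *: p + q)) ->
  (forall p q, P p -> P q -> P (p * q)) -> (forall i, P 'X_i) ->
  forall p, P p.
Proof.
move=> P1 PD PM PX.
have P0 : P 0 by rewrite -(addNr 1) -scaleN1r; apply: PD.
elim/mpolyind=> // c m p _ _ Pp; apply: PD => //.
rewrite mpolyXE_id; elim/big_ind: _ => // i _.
by elim: (m i) => // e IH; rewrite exprS; apply: PM.
Qed.

(** Reduces the product rule for linear coefficients to [mderivM]. *)
Lemma mcoeff_deriv0 (n : nat) (R : comNzRingType) (i : 'I_n) (p : {mpoly R[n]}) :
  (p^`M(i))@_0%MM = p@_U_(i).
Proof. by rewrite mcoeff_deriv mnm0E mulr1n add0m. Qed.

Section Evaluation.
Variables (k : fieldType) (A : algType k).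
Hypothesis mulAC : forall x y : A, x * y = y * x.
Variables (l : nat) (x : 'I_l -> A).
Implicit Types p q : {mpoly k[l]}.

Definition generating (T : Type) (y : T -> A) : Prop :=
  forall B : set A, GRing.subalg_closed (mem B) -> (forall i, B (y i)) ->
  forall a, B a.

Definition mev p : A := mmap (in_alg A) x p.

Lemma mev_linear : linear mev.
Proof. by move=> a p q; rewrite /mev mmapD mmapZ /= mulr_algl. Qed.

HB.instance Definition _ :=
  GRing.isLinear.Build k {mpoly k[l]} A *:%R mev mev_linear.

Lemma mev_monoid_morphism : monoid_morphism mev.
Proof.
by split; case: (@commr_mmap_is_multiplicative _ k A x (in_alg A)) => // ? *;
  apply: mulAC.
Qed.

Lemma mevM p q : mev (p * q) = mev p * mev q.
Proof. by case: mev_monoid_morphism. Qed.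

Lemma mev1 : mev 1 = 1.
Proof. by case: mev_monoid_morphism. Qed.

Lemma mevX m : mev 'X_[m] = \prod_i x i ^+ m i.
Proof. exact: mmapX. Qed.

Lemma mevXU i : mev 'X_i = x i.
Proof. by rewrite /mev mmapX mmap1U. Qed.

Lemma mevE p : mev p = \sum_(m <- msupp p) p@_m *: mev 'X_[m].
Proof.
by rewrite {1}[p]mpolyE linear_sum; apply: eq_bigr => m _; rewrite linearZ.
Qed.

Lemma mev_surj : generating x -> forall a, exists p, mev p = a.
Proof.
move=> gen; apply: (gen [set a | exists p, mev p = a]%classic) => [|i]; last first.
  by exists 'X_i; rewrite mevXU.
split=> [|a u v|u v]; rewrite !inE; first by exists 1; rewrite mev1.
  by move=> [p <-] [q <-]; exists (a *: p + q); rewrite linearP.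
by move=> [p <-] [q <-]; exists (p * q); rewrite mevM.
Qed.

(** Both sides are linear in [p], obey the same Leibniz rule and agree on the variables. *)
Lemma mev_chain_rule (D : {linear A -> A}) :
  (forall a b, D (a * b) = D a * b + a * D b) ->
  forall p, D (mev p) = \sum_i mev p^`M(i) * D (x i).
Proof.
move=> DM; elim/mpoly_subalg_ind=> [|a p q IHp IHq|p q IHp IHq|i].
- rewrite big1 => [|i _]; last by rewrite -mpolyC1 mderivC linear0 mul0r.
  by rewrite mev1; apply: (@addrI _ (D 1)); rewrite addr0 -{3}[1]mulr1 DM mulr1 mul1r.
- rewrite !linearP IHp IHq scaler_sumr -big_split; apply: eq_bigr => i _ /=.
  by rewrite !linearP mulrDl -scalerAl.
- rewrite mevM DM IHp IHq mulr_suml mulr_sumr -big_split; apply: eq_bigr => i _ /=.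
  rewrite mderivM linearD /= !mevM mulrDl mulrA; congr (_ + _).
  by rewrite -!mulrA; congr (_ * _); apply: mulAC.
- rewrite mevXU (bigD1 i) //= big1 => [|j neq_ji]; last first.
    by rewrite mderivX mnm1E eq_sym (negbTE neq_ji) scale0r linear0 mul0r.
  by rewrite mderivX mnm1E eqxx -{1}[U_(i)%MM]add0m addmK mpolyX0 scale1r mev1 mul1r addr0.
Qed.

(** By induction on the degree all partial derivatives of a relation are zero polynomials. In
    characteristic 0 the relation is then constant, and a constant that evaluates to 0 is 0. *)
Lemma mev_inj_deriv : [pchar k] =i pred0 ->
  (forall p, mev p = 0 -> forall i, mev p^`M(i) = 0) ->
  forall p, mev p = 0 -> p = 0.
Proof.
move=> char0 dclosed p.
(* A strict degree bound, so that the base case 0 means the zero polynomial. *)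
have : exists n, forall m, (n <= mdeg m)%N -> p@_m = 0.
  by exists (msize p) => m /msize_mdeg_ge/memN_msupp_eq0.
case=> n; elim: n p => [|n IH] p deg_p p0.
  by apply/mpolyP=> m; rewrite mcoeff0; apply: deg_p.
have dp0 i : p^`M(i) = 0.
  apply: IH (dclosed p p0 i) => m le_nm.
  by rewrite mcoeff_deriv deg_p ?mul0rn // mdegD mdeg1 addn1.
have pE : p = (p@_0%MM)%:MP.
  apply/mpolyP=> m; rewrite mcoeffC.
  have [->|m_neq0] := eqVneq m 0%MM; first by rewrite mulr1.
  rewrite mulr0; have [i mi_neq0] : exists i, m i != 0%N.
    apply/existsP; rewrite -negb_forall; apply: contra m_neq0 => /forallP m0.
    by apply/eqP/mnmP=> i; rewrite mnm0E; apply/eqP.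
  have Um : (U_(i) <= m)%MM by rewrite lep1mP.
  (* This coefficient of the derivative is [m i] times [p@_m]. *)
  have := congr1 (mcoeff (m - U_(i))%MM) (dp0 i).
  rewrite mcoeff_deriv submK // mcoeff0 => /eqP.
  by rewrite -mulr_natr mulf_eq0 ((pcharf0P k).1 char0) orbF => /eqP.
move: p0; rewrite pE -alg_mpolyC linearZ /= mev1 => /eqP.
by rewrite scaler_eq0 oner_eq0 orbF => /eqP->; rewrite scale0r.
Qed.

End Evaluation.

(** * Weighted homogeneous parts of polynomials *)

Section WeightedParts.
Variables (k : fieldType) (A : algType k) (A_ : nat -> set A).
Hypothesis Agr : graded_algebra A_.
Variables (l : nat) (x : 'I_l -> A) (d : 'I_l -> nat).
Hypothesis A_x : forall i, A_ (d i) (x i).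
Hypothesis d_gt0 : forall i, (0 < d i)%N.
Implicit Types (p : {mpoly k[l]}) (m : 'X_{1..l}).

Let sA n : subspace (A_ n).
Proof. by case: Agr => -[+ _ _] _ _; apply. Qed.
Let A_1 : A_ 0%N 1.
Proof. by case: Agr. Qed.
Let A_M i j a b : A_ i a -> A_ j b -> A_ (i + j)%N (a * b).
Proof. by case: Agr => _ _; apply. Qed.

Definition mnm_weight m := (\sum_i m i * d i)%N.

Definition weight_part n p : {mpoly k[l]} :=
  \sum_(m <- msupp p | mnm_weight m == n) p@_m *: 'X_[m].

Lemma mcoeff_weight_part n p m :
  (weight_part n p)@_m = if mnm_weight m == n then p@_m else 0.
Proof.
rewrite /weight_part raddf_sum /=.
have [m_supp|m_supp] := boolP (m \in msupp p); last first.
  rewrite (memN_msupp_eq0 m_supp) if_same big1_seq // => m' /andP[_ m'_supp].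
  rewrite mcoeffZ mcoeffX; case: eqP => [m'm|]; last by rewrite mulr0.
  by rewrite -m'm m'_supp in m_supp.
rewrite big_mkcond (bigD1_seq m) ?msupp_uniq //= big1 => [|m' neq_m'm].
  by rewrite addr0 mcoeffZ mcoeffX eqxx mulr1.
by case: ifP => // _; rewrite mcoeffZ mcoeffX (negbTE neq_m'm) mulr0.
Qed.

Lemma weight_partN n p : weight_part n (p - weight_part n p) = 0.
Proof.
apply/mpolyP=> m; rewrite mcoeff_weight_part mcoeffB mcoeff_weight_part mcoeff0.
by case: (_ == n); rewrite ?subrr.
Qed.

Lemma mpoly_weight_sum p : exists N, forall n, (N <= n)%N ->
  p = \sum_(i < n) weight_part i p.
Proof.
(* The sum of all weights is a crude bound for each of them. *)
exists (\sum_(m <- msupp p) mnm_weight m).+1 => n lt_n.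
apply/mpolyP=> m; rewrite raddf_sum /=.
under eq_bigr => i _ do rewrite mcoeff_weight_part.
have [m_supp|/memN_msupp_eq0 ->] := boolP (m \in msupp p); last first.
  by rewrite big1 // => i _; rewrite if_same.
have ltmn : (mnm_weight m < n)%N.
  apply: leq_ltn_trans lt_n; rewrite (big_rem _ m_supp) /=.
  exact: leq_addr.
rewrite (bigD1 (Ordinal ltmn)) //= eqxx big1 ?addr0 // => i.
by rewrite -val_eqE /= eq_sym => /negbTE->.
Qed.

Lemma mevX_homog m : A_ (mnm_weight m) (mev x 'X_[m]).
Proof.
rewrite mevX; apply: (big_ind2 (fun a n => A_ n a)) => // [a i b j|i _].
  exact: A_M.
by elim: (m i) => [|e IH]; rewrite ?expr0 // exprS mulSn; apply: A_M.
Qed.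

Lemma mev_weight_part n p : A_ n (mev x (weight_part n p)).
Proof.
rewrite linear_sum; apply: subspace_sum => // m /eqP <-.
by rewrite linearZ; apply: subspaceZ => //; apply: mevX_homog.
Qed.

(** The kernel of evaluation is homogeneous: weight parts evaluate to homogeneous components, which
    are independent. *)
Lemma mev_weight_part0 p n : mev x p = 0 -> mev x (weight_part n p) = 0.
Proof.
case: Agr => -[_ _ A_free] _ _; case: (mpoly_weight_sum p) => N /(_ (N + n.+1)%N).
rewrite leq_addr => /(_ isT) pE p0.
apply: (A_free (N + n.+1)%N (fun i => mev x (weight_part i p))) => [i||].
- exact: mev_weight_part.
- by rewrite -linear_sum -pE.
- by rewrite addnS ltnS leq_addl.
Qed.

Lemma mev_homog_weight p n : A_ n (mev x p) -> weight_part n p = 0 -> mev x p = 0.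
Proof.
case: Agr => Adec _ _; case: (mpoly_weight_sum p) => N /(_ _ (leqnn N)) pE.
have -> : mev x p = \sum_(i < N) mev x (weight_part i p).
  by rewrite {1}pE linear_sum.
move=> An pn0.
apply: (direct_sum_exclude Adec (f := fun i => mev x (weight_part i p)) (n := n)) => //.
  by move=> i; apply: mev_weight_part.
by rewrite pn0 linear0.
Qed.

Lemma mnm_weightU i : mnm_weight U_(i) = d i.
Proof.
rewrite /mnm_weight (bigD1 i) //= mnm1E eqxx mul1n big1 ?addn0 // => j neq_ji.
by rewrite mnm1E eq_sym (negbTE neq_ji).
Qed.

(** One occurrence of the [i]-th variable already uses up the weight [d i], and all weights are
    positive. *)
Lemma mnm_weight_eq m i : mnm_weight m = d i -> m != U_(i)%MM -> m i = 0%N.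
Proof.
move=> wm; apply: contraNeq; rewrite -lt0n => mi_gt0; apply/eqP/mnmP=> j.
move: wm; rewrite /mnm_weight (bigD1 i) //=.
case mi: (m i) mi_gt0 => [//|e] _ /eqP.
rewrite mulSn -addnA -[X in _ == X]addn0 eqn_add2l addn_eq0 muln_eq0.
rewrite (gtn_eqF (d_gt0 i)) orbF => /andP[/eqP e0 rest0].
rewrite mnm1E eq_sym; case: eqP => [->|/eqP neq_ji]; first by rewrite mi e0.
move: rest0; rewrite sum_nat_eq0 => /forall_inP/(_ j neq_ji).
by rewrite muln_eq0 (gtn_eqF (d_gt0 j)) orbF => /eqP.
Qed.

Definition irredundant := forall i,
  ~ (forall B : set A, GRing.subalg_closed (mem B) ->
     (forall j, j != i -> B (x j)) -> B (x i)).

(* In a homogeneous relation of degree [d i], the only monomial involving the *)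
(* [i]-th variable is that variable itself; if it occurred, [x i] would be a  *)
(* polynomial in the other generators.                                        *)
Lemma irredundant_linear_coeff : irredundant ->
  forall p i, mev x p = 0 -> p@_U_(i) = 0.
Proof.
move=> irr p i p0; apply/eqP; apply: contraPT (irr i) => c_neq0; apply.
move=> B sB Bx.
have [B1 BD BM] : [/\ B 1, (forall a u v, B u -> B v -> B (a *: u + v))
                     & forall u v, B u -> B v -> B (u * v)].
  case: sB => B1 BD BM; split=> [|a u v Bu Bv|u v Bu Bv].
  - by have := B1; rewrite inE.
  - by have := BD a u v; rewrite !inE; apply.
  - by have := BM u v; rewrite !inE; apply.
have sBs : subspace B.
  by apply/subspaceP; split=> //; rewrite -(addNr 1) -scaleN1r; apply: BD.
set q := weight_part (d i) p.
have qU : q@_U_(i) = p@_U_(i) by rewrite mcoeff_weight_part mnm_weightU eqxx.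
have U_q : U_(i)%MM \in msupp q by rewrite mcoeff_msupp qU.
have := mev_weight_part0 (d i) p0; rewrite -/q mevE (bigD1_seq _ U_q) ?msupp_uniq //=.
rewrite qU mevXU => /eqP; rewrite addrC addr_eq0 => /eqP qE.
(* The other monomials of weight [d i] avoid the [i]-th variable, so their values lie in [B]. *)
have : B (- (p@_U_(i) *: x i)).
  rewrite -qE big_seq_cond; apply: subspace_sum => // m /andP[m_q neq_mU].
  apply: subspaceZ => //.
  have wm : mnm_weight m = d i.
    move: m_q; rewrite mcoeff_msupp mcoeff_weight_part.
    by case: (mnm_weight m =P d i) => //; rewrite eqxx.
  rewrite mevX; elim/big_ind: _ => // j _.
  have [->|neq_ji] := eqVneq j i; first by rewrite (mnm_weight_eq wm) ?expr0.
  by elim: (m j) => [|e IH]; rewrite ?expr0 // exprS; apply: BM => //; apply: Bx.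
move/(subspaceN sBs); rewrite opprK => /(subspaceZ (p@_U_(i))^-1 sBs).
by rewrite scalerA mulVf // scale1r.
Qed.

End WeightedParts.

(** * Minimal homogeneous generators *)

Section HomogeneousGenerators.
Variables (k : fieldType) (A : algType k) (A_ : nat -> set A).
Hypothesis Agr : graded_algebra A_.
Hypothesis A0 : forall a, A_ 0%N a -> exists c, a = c%:A.

Definition homog_generators l (x : 'I_l -> A) (d : 'I_l -> nat) :=
  [/\ generating x, forall i, A_ (d i) (x i) & forall i, (0 < d i)%N].

Lemma homog_generators_exist : finitely_generated A ->
  exists l (x : 'I_l -> A) d, homog_generators x d.
Proof.
case=> s s_gen.
have [L [LA LB]] : exists L : seq (nat * A),
    (forall u, u \in L -> A_ u.1 u.2 /\ (0 < u.1)%N) /\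
    (forall B : set A, GRing.subalg_closed (mem B) ->
       (forall u, u \in L -> B u.2) -> forall a, a \in s -> B a).
  elim: s {s_gen} => [|a s [L [LA LB]]]; first by exists [::].
  case: Agr => -[sA A_gen _] _ _; have [N [f [Af aE]]] := A_gen a.
  exists ([seq (n.+1, f n.+1) | n <- iota 0 N] ++ L); split=> [u|B sB BL b].
    rewrite mem_cat => /orP[/mapP[n _ ->]|/LA //].
    by split=> //; apply: Af.
  rewrite inE => /predU1P[->|]; last first.
    by apply: LB => // u Lu; apply: BL; rewrite mem_cat Lu orbT.
  have sBs : subspace B.
    have [B1 BD _] := sB; apply/subspaceP; split=> [|c u v Bu Bv].
      have := BD (-1) 1 1 B1 B1; rewrite scaleN1r addNr inE; exact.
    by have := BD c u v; rewrite !inE; apply.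
  rewrite aE; apply: subspace_sum => // -[[|n] ltnN] _ /=.
    have [c ->] := A0 (Af 0%N).
    by apply: subspaceZ => //; case: sB => + _ _; rewrite inE.
  apply: (BL (n.+1, f n.+1)); rewrite mem_cat; apply/orP; left.
  by apply/mapP; exists n => //; rewrite mem_iota /= add0n ltnW.
exists (size L), (fun i => (tnth (in_tuple L) i).2), (fun i => (tnth (in_tuple L) i).1).
split=> [B sB BL a|i|i].
- have : [set: A]%classic a by [].
  rewrite -s_gen; apply; split=> // b /=; apply: LB => // u /(@tnthP _ _ (in_tuple L))[i ->].
  exact: BL.
- by have [] := LA _ (mem_tnth i (in_tuple L)).
- by have [] := LA _ (mem_tnth i (in_tuple L)).
Qed.

(** A homogeneous generating family of minimal size works, since a redundant member could be removed
    through [lift i]. *)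
Lemma irredundant_generators_exist : finitely_generated A ->
  exists l (x : 'I_l -> A) d, homog_generators x d /\ irredundant x.
Proof.
move=> fgA.
pose P l := `[< exists (x : 'I_l -> A) d, homog_generators x d >].
have exP : exists l, P l.
  by have [l xd] := homog_generators_exist fgA; exists l; apply/asboolP.
case: (ex_minnP exP) => l /asboolP[x [d xd]] l_min.
exists l, x, d; split=> // i red.
case: l => [|l] in x d xd l_min i red *; first by case: i red.
have : P l; last by move/l_min; rewrite ltnn.
apply/asboolP; exists (x \o lift i), (d \o lift i).
case: xd => gen xA d_gt0; split=> [B sB Bx|j|j] /=; [|exact: xA|exact: d_gt0].
have Bx' j : j != i -> B (x j).
  by rewrite eq_sym => /unlift_some[j' -> _]; apply: Bx.
by apply: gen => // j; have [->|] := eqVneq j i; [apply: red|apply: Bx'].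
Qed.

End HomogeneousGenerators.

(** * Derivations dual to the generators *)

Section DualDerivations.
Variables (k : fieldType) (K : hopfAlgType k) (K_ : nat -> set K).
Hypothesis Kcoradgr : coradically_graded K_.
Hypothesis Kconn : connected K.
Variables (l : nat) (x : 'I_l -> K) (d : 'I_l -> nat).
Hypothesis x_gen : homog_generators K_ x d.
Hypothesis x_irr : irredundant x.

Let mulKC := coradically_graded_comm Kcoradgr Kconn.
Let Kgr : graded_algebra K_.
Proof. by case: Kcoradgr => -[]. Qed.
Let K_x i : K_ (d i) (x i).
Proof. by case: x_gen. Qed.
Let d_gt0 i : (0 < d i)%N.
Proof. by case: x_gen. Qed.
Let x_surj : forall a, exists p, mev x p = a.
Proof. by apply: (mev_surj mulKC); case: x_gen. Qed.

(** Read off an arbitrarily chosen polynomial representing [a]; [linear_coeffE] shows independence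
    of the choice. These are the coordinates on the augmentation ideal modulo its square. *)
Definition linear_coeff (i : 'I_l) (a : K) : k^o := (sval (cid (x_surj a)))@_U_(i).

Lemma linear_coeffE i p : linear_coeff i (mev x p) = p@_U_(i).
Proof.
rewrite /linear_coeff; case: cid => q /= qp.
have qp0 : mev x (q - p) = 0 by rewrite linearB /= qp subrr.
have /eqP := irredundant_linear_coeff Kgr K_x d_gt0 x_irr i qp0.
by rewrite mcoeffB subr_eq0 => /eqP.
Qed.

Lemma linear_coeff_gen i j : linear_coeff i (x j) = (j == i)%:R.
Proof. by rewrite -mevXU linear_coeffE mcoeffX eq_mnm1. Qed.

Lemma linear_coeff_linear i : linear (linear_coeff i).
Proof.
move=> c a b; have [[p <-] [q <-]] := (x_surj a, x_surj b).
by rewrite -linearP !linear_coeffE mcoeffD mcoeffZ.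
Qed.

HB.instance Definition _ i :=
  GRing.isLinear.Build k K k^o *:%R (linear_coeff i) (linear_coeff_linear i).

Lemma counit_mev p : counit (mev x p) = p@_0%MM.
Proof.
elim/mpoly_subalg_ind: p => [|c p q IHp IHq|p q IHp IHq|i].
- by rewrite mev1 // rmorph1 mcoeff1 eqxx.
- by rewrite !linearP /= IHp IHq.
- by rewrite mevM // !rmorphM /= IHp IHq.
- by rewrite mevXU (homog_counit Kcoradgr (d_gt0 i)) // mcoeffX mnm1_eq0.
Qed.

Lemma linear_coeffM i a b :
  linear_coeff i (a * b) = linear_coeff i a * counit b + counit a * linear_coeff i b.
Proof.
have [[p <-] [q <-]] := (x_surj a, x_surj b).
rewrite -mevM // !linear_coeffE !counit_mev -!mcoeff_deriv0 mderivM.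
by rewrite mcoeffD !rmorphM.
Qed.

(** Deleting the part of weight [n] from a representative of [a] keeps the coefficient at [U_(i)],
    but leaves a value of degree [n] with no component there, hence 0. *)
Lemma linear_coeff_homog i n a : K_ n a -> n != d i -> linear_coeff i a = 0.
Proof.
move=> Ka neq_n; have [p pa] := x_surj a.
pose q := p - weight_part d n p.
have -> : linear_coeff i a = q@_U_(i).
  rewrite -pa linear_coeffE /q mcoeffB mcoeff_weight_part mnm_weightU.
  by rewrite eq_sym (negbTE neq_n) subr0.
rewrite -linear_coeffE.
suff -> : mev x q = 0 by rewrite linear0.
apply: (mev_homog_weight Kgr K_x (n := n)); last exact: weight_partN.
rewrite linearB /= pa; apply: (subspaceD (homog_subspace Kcoradgr n)) => //.
by apply: (subspaceN (homog_subspace Kcoradgr n)); apply: mev_weight_part.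
Qed.

Definition dual_deriv (i : 'I_l) (a : K) : K := slice (linear_coeff i) (comul a).

Lemma dual_deriv_linear i : linear (dual_deriv i).
Proof. by move=> c a b; rewrite /dual_deriv !linearP. Qed.

HB.instance Definition _ i :=
  GRing.isLinear.Build k K K *:%R (dual_deriv i) (dual_deriv_linear i).

Lemma dual_derivM i a b :
  dual_deriv i (a * b) = dual_deriv i a * b + a * dual_deriv i b.
Proof.
rewrite /dual_deriv rmorphM /= (slice_mul (linear_coeffM i)).
by rewrite /slice !comul_counitr.
Qed.

(** The right factors of the coproduct have degree at most [n], below the only degree that
    [linear_coeff i] detects. *)
Lemma dual_deriv_lt i n a : K_ n a -> (n < d i)%N -> dual_deriv i a = 0.
Proof.
move=> Ka lt_n; rewrite /dual_deriv; move: (comul a) (homog_comul Kcoradgr Ka).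
apply: homog_tensor_ind => [|j b c le_jn Kb Kc] /=.
  apply/subspaceP; split=> [|e t u t0 u0] /=; first exact: linear0.
  by rewrite linearP /= t0 u0 scaler0 addr0.
rewrite sliceE /= (linear_coeff_homog Kc) ?scale0r //.
by rewrite ltn_eqF // (leq_ltn_trans (leq_subr _ _)).
Qed.

(** Only the component of the coproduct in K(0) ⊗ K(d_i) survives, so the value is a scalar. *)
Lemma dual_deriv_eq i a : K_ (d i) a -> dual_deriv i a = (linear_coeff i a : k)%:A.
Proof.
move=> Ka.
have [c Dc] : exists c, dual_deriv i a = c%:A.
  apply: (homog0P Kcoradgr Kconn).
  rewrite /dual_deriv; move: (comul a) (homog_comul Kcoradgr Ka).
  apply: homog_tensor_ind => [|j b e le_jn Kb Ke] /=.
    exact: (subspace_preim (slice (linear_coeff i)) (homog_subspace Kcoradgr 0)).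
  have sK0 := homog_subspace Kcoradgr 0.
  rewrite sliceE; have [j0|j_gt0] := posnP j.
    by apply: subspaceZ => //; rewrite -[0%N]j0.
  rewrite /= (linear_coeff_homog Ke) ?scale0r; first by case/subspaceP: sK0.
  by have := d_gt0 i; lia.
(* The counit identifies the scalar [c]: contracting the left factor by it turns the coproduct of
   [a] back into [a]. *)
have := slice_slice (@counit k K) (linear_coeff i) (comul a).
rewrite comul_counitl -/(dual_deriv i a) Dc linearZ /= rmorph1 => <-.
by congr (_ *: _); apply/esym/mulr1.
Qed.

Lemma mev_inj : [pchar k] =i pred0 -> injective (mev x).
Proof.
move=> char0 p q pq; apply/eqP; rewrite -subr_eq0; apply/eqP.
have: mev x (p - q) = 0 by rewrite linearB /= pq subrr.
move: (p - q) => {p q pq}; apply: (mev_inj_deriv mulKC char0) => p p0 i.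
(* Descending induction on [d i]. In the chain rule for D_i, generators of larger degree contribute
   0 by induction; the others have D_i x_j = 0, except D_i x_i = 1. *)
have [n] := ubnP (\max_j d j - d i)%N; elim: n i => // n IH i.
rewrite ltnS => le_n.
have := mev_chain_rule mulKC x (dual_derivM i) p.
rewrite p0 linear0 (bigD1 i) //= dual_deriv_eq // linear_coeff_gen eqxx.
rewrite scale1r mulr1 big1 ?addr0 // => j neq_ji.
have [lt_d|gt_d|eq_d] := ltngtP (d j) (d i).
- by rewrite (dual_deriv_lt (K_x j)) ?mulr0.
- rewrite IH ?mul0r //; apply: leq_trans le_n.
  have := leq_bigmax j (F := d); lia.
- rewrite dual_deriv_eq -?eq_d // linear_coeff_gen (negbTE neq_ji).
  by rewrite scale0r mulr0.
Qed.

End DualDerivations.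

(** * The isomorphism with a polynomial ring *)

Theorem theorem1p2 (k : closedFieldType) (chark : [pchar k] =i pred0)
    (K : hopfAlgType k) (K_ : nat -> set K)
    (Kcoradgr : coradically_graded K_) (Kconn : connected K)
    (Kfg : finitely_generated K) :
  exists (l : nat) (phi : {lrmorphism K -> {mpoly k[l]}}), bijective phi.
Proof.
have Kgr : graded_algebra K_ by case: Kcoradgr => -[].
have mulKC := coradically_graded_comm Kcoradgr Kconn.
have [l [x [d [x_gen x_irr]]]] :=
  irredundant_generators_exist Kgr (homog0P Kcoradgr Kconn) Kfg.
have inj_x := mev_inj Kcoradgr Kconn x_gen x_irr chark.
have x_surj : forall a, exists p, mev x p = a.
  by apply: (mev_surj mulKC); case: x_gen.
(* The inverse of evaluation, chosen pointwise; it inherits the algebra laws by injectivity of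
   [mev x]. *)
pose phi a := sval (cid (x_surj a)).
have phiK : cancel phi (mev x) by move=> a; rewrite /phi; case: cid.
have mevK : cancel (mev x) phi by move=> p; apply: inj_x; rewrite phiK.
have phi_lin : linear phi.
  by move=> c a b; apply: inj_x; rewrite linearP /= !phiK.
have phi_mul : monoid_morphism phi.
  by split=> [|a b]; apply: inj_x; rewrite ?mev1 ?mevM ?phiK.
pose phiL := GRing.isLinear.Build k K {mpoly k[l]} *:%R phi phi_lin.
pose phiM := GRing.isMonoidMorphism.Build K {mpoly k[l]} phi phi_mul.
pose phiLR : {lrmorphism K -> {mpoly k[l]}} := HB.pack phi phiL phiM.
by exists l, phiLR; exists (mev x).
Qed.
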